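(* Let $r\in\mathbb{N}$, $m_1,\ldots,m_r\in\mathbb{N}$, $m=\operatorname{lcm}(m_1,\ldots,m_r)$ and $\mathbf{a}=(a_1,\ldots,a_r)\in\mathbb{Z}^r$. Then $$\frac1m\sum_{k=1}^m c_{m_1}(k-a_1)\cdots c_{m_r}(k-a_r)=\sum_{d_1\mid m_1,\ldots,d_r\mid m_r}\frac{d_1\mu(m_1/d_1)\cdots d_r\mu(m_r/d_r)}{\operatorname{lcm}(d_1,\ldots,d_r)}N_{(\mathbf a)}(d_1,\ldots,d_r),$$ where $N_{(\mathbf a)}(d_1,\ldots,d_r)=1$ if $\gcd(d_i,d_j)\mid a_i-a_j$ for all $1\le i,j\le r$, and $N_{(\mathbf a)}(d_1,\ldots,d_r)=0$ otherwise.
   Context: For $n\in\mathbb{N}$ and $k\in\mathbb{Z}$, $c_n(k)=\sum_{1\le j\le n,\ \gcd(j,n)=1}\exp(2\pi i jk/n)$ is the Ramanujan sum. $\mu$ is the Möbius function. *)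

(* Defs.v *)
From mathcomp Require Import all_boot all_order all_algebra.
From mathcomp Require Import complex.
From mathcomp Require Import reals sequences trigo.

Set Implicit Arguments.
Unset Strict Implicit.
Unset Printing Implicit Defensive.

Import GRing.Theory Num.Theory.

Local Open Scope ring_scope.
Local Open Scope complex_scope.

(* exp (x + i y) = e^x (cos y + i sin y) *)
Definition expC (R : realType) (z : R[i]) : R[i] :=
  (expR (complex.Re z))%:C * (cos (complex.Im z) +i* sin (complex.Im z)).

Definition ramanujan_sum (R : realType) (n : nat) (k : int) : R[i] :=
  \sum_(1 <= j < n.+1 | coprime j n)
    expC (2 * (pi : R)%:C * 'i * j%:R * k%:~R / n%:R).

Definition squarefree (n : nat) : bool :=
  (0 < n)%N && ~~ has (fun p => p ^ 2 %| n)%N (primes n).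

Definition mobius (n : nat) : int :=
  if squarefree n then (-1) ^+ size (primes n) else 0.

Definition lcm_fam (r : nat) (d : 'I_r -> nat) : nat :=
  \big[lcmn/1%N]_(i < r) d i.

Definition N_compat (r : nat) (a : 'I_r -> int) (d : 'I_r -> nat) : nat :=
  if [forall i, forall j, ((gcdn (d i) (d j))%:Z %| a i - a j)%Z] then 1 else 0.

(* Main.v *)
Require Import Defs.
From mathcomp Require Import all_boot all_order all_algebra.
From mathcomp Require Import complex.
From mathcomp Require Import reals exp trigo.
From mathcomp Require Import zify ring lra.

Set Implicit Arguments.
Unset Strict Implicit.
Unset Printing Implicit Defensive.

Import Order.TTheory GRing.Theory Num.Theory.
Local Open Scope ring_scope.
Local Open Scope complex_scope.

(* Moebius inversion over the common divisors of [j] and [n], combined with the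
   orthogonality of roots of unity, gives
   [c_n(k) = \sum_(d | n, d | k) d * mu(n / d)].  Expanding the product of these
   sums and exchanging summations reduces the mean value to counting the [k] in
   [1, m] with [d_i | k - a_i] for all [i].  By the Chinese remainder theorem for
   moduli that need not be coprime, this system is solvable exactly when
   [gcd(d_i, d_j) | a_i - a_j] for all [i, j], and then its solutions form one
   residue class modulo [lcm(d_1, ..., d_r)]. *)

(** * The Moebius function *)

Lemma perm_primes_coprimeM (m n : nat) : (0 < m)%N -> (0 < n)%N ->
  coprime m n -> perm_eq (primes (m * n)) (primes m ++ primes n).
Proof.
move=> m_gt0 n_gt0 mn_coprime; apply: uniq_perm; rewrite ?primes_uniq //.
  by rewrite cat_uniq !primes_uniq -coprime_has_primes // mn_coprime.
by move=> p; rewrite mem_cat primesM.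
Qed.

Lemma squarefree_coprimeM (m n : nat) : coprime m n ->
  squarefree (m * n) = squarefree m && squarefree n.
Proof.
move=> mn_coprime; rewrite /squarefree muln_gt0.
have [->|m_gt0] //= := posnP m; have [->|n_gt0] := posnP n; first by rewrite andbF.
rewrite (perm_has _ (perm_primes_coprimeM m_gt0 n_gt0 mn_coprime)) has_cat negb_or.
congr (~~ _ && ~~ _); apply: eq_in_has => p.
  rewrite mem_primes => /and3P[_ _ p_m]; rewrite Gauss_dvdl //.
  by rewrite coprimeXl // (coprime_dvdl p_m).
rewrite mem_primes => /and3P[_ _ p_n]; rewrite Gauss_dvdr //.
by rewrite coprimeXl // coprime_sym (coprime_dvdr p_n).
Qed.

Lemma mobius_coprimeM (m n : nat) : coprime m n ->
  mobius (m * n) = mobius m * mobius n.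
Proof.
move=> mn_coprime; rewrite /mobius squarefree_coprimeM //.
case: ifP => [/andP[m_sqf n_sqf]|/negbT]; last first.
  by rewrite negb_and => /orP[] /negPf->; rewrite ?mul0r ?mulr0.
have [[m_gt0 _] [n_gt0 _]] := (andP m_sqf, andP n_sqf).
rewrite m_sqf n_sqf (perm_size (perm_primes_coprimeM m_gt0 n_gt0 mn_coprime)).
by rewrite size_cat exprD.
Qed.

Lemma mobius_prime (p : nat) : prime p -> mobius p = -1.
Proof.
move=> p_prime; rewrite /mobius /squarefree primes_prime // prime_gt0 //= orbF.
by rewrite gtnNdvd ?prime_gt0 // -[X in (X < _)%N]expn1 ltn_exp2l ?prime_gt1.
Qed.

Lemma mobius_sqr_dvd (p n : nat) : prime p -> (p ^ 2 %| n)%N -> mobius n = 0.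
Proof.
move=> p_prime p2_n; rewrite /mobius /squarefree; case: posnP => //= n_gt0.
suff -> : has (fun q => q ^ 2 %| n)%N (primes n) by [].
apply/hasP; exists p => //; rewrite mem_primes p_prime n_gt0.
by rewrite (dvdn_trans _ p2_n) // dvdn_exp.
Qed.

Lemma sum_dvdn_mul (V : nmodType) (c : nat) (s t : seq nat) (F : nat -> V) :
  (0 < c)%N -> uniq s -> uniq t -> (forall e, (c * e \in s)%N = (e \in t)) ->
  \sum_(j <- s | (c %| j)%N) F j = \sum_(e <- t) F (c * e)%N.
Proof.
move=> c_gt0 s_uniq t_uniq st; rewrite -big_filter -(big_map (muln c) xpredT).
apply: perm_big; apply: uniq_perm; rewrite ?filter_uniq //.
  by rewrite map_inj_uniq // => x y /eqP; rewrite eqn_pmul2l // => /eqP.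
move=> j; rewrite mem_filter; apply/andP/mapP => [[/dvdnP[e ->]]|[e e_t ->]].
  by rewrite mulnC st => e_t; exists e.
by rewrite dvdn_mulr // st.
Qed.

Lemma sum_divisors_exact_prime (V : nmodType) (p n : nat) (F : nat -> V) :
  (0 < n)%N -> prime p -> (p %| n)%N ->
  \sum_(e <- divisors n | (p %| e)%N && ~~ (p ^ 2 %| e)%N) F e =
  \sum_(e <- divisors n | ~~ (p %| e)%N) F (p * e)%N.
Proof.
move=> n_gt0 p_prime p_n; have p_gt0 := prime_gt0 p_prime.
under eq_bigl do rewrite andbC.
rewrite -big_filter_cond -[RHS]big_filter.
apply: sum_dvdn_mul; rewrite ?filter_uniq ?divisors_uniq // => e.
rewrite !mem_filter -!dvdn_divisors // dvdn_pmul2l //.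
by have [|pNe] := boolP (p %| e)%N; rewrite //= Gauss_dvd ?p_n // prime_coprime.
Qed.

(* For a prime [p] dividing [n], the divisors [e] of [n] with [p] not dividing
   [e] cancel against the [p * e]; the others are divisible by [p ^ 2]. *)
Lemma sum_mobius_divisors (n : nat) :
  (0 < n)%N -> \sum_(e <- divisors n) mobius e = (n == 1)%N%:R.
Proof.
move=> n_gt0; have [->|n_neq1] := eqVneq n 1%N; first by rewrite big_seq1.
have p_prime : prime (pdiv n) by rewrite pdiv_prime // ltn_neqAle eq_sym n_neq1.
rewrite (bigID (fun e => pdiv n %| e)%N) /=.
rewrite (bigID (fun e => pdiv n ^ 2 %| e)%N) /= [X in X + _ + _]big1; last first.
  by move=> e /andP[_ /(mobius_sqr_dvd p_prime)].
rewrite add0r sum_divisors_exact_prime ?pdiv_dvd // -big_split big1 // => e pNe /=.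
by rewrite mobius_coprimeM ?prime_coprime // mobius_prime // mulN1r addNr.
Qed.

Lemma sum_mobius_common_divisors (j n : nat) : (0 < j)%N -> (0 < n)%N ->
  \sum_(e <- divisors n | (e %| j)%N) mobius e = (coprime j n)%:R.
Proof.
move=> j_gt0 n_gt0; have g_gt0 : (0 < gcdn j n)%N by rewrite gcdn_gt0 j_gt0.
rewrite -(sum_mobius_divisors g_gt0) -big_filter; apply: perm_big.
apply: uniq_perm; rewrite ?filter_uniq ?divisors_uniq // => e.
by rewrite mem_filter -!dvdn_divisors // dvdn_gcd.
Qed.

Lemma sum_coprime_mobius (V : zmodType) (n : nat) (F : nat -> V) : (0 < n)%N ->
  \sum_(1 <= j < n.+1 | coprime j n) F j =
  \sum_(e <- divisors n) (\sum_(1 <= j < (n %/ e).+1) F (e * j)%N) *~ mobius e.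
Proof.
move=> n_gt0; transitivity (\sum_(1 <= j < n.+1)
    \sum_(e <- divisors n | (e %| j)%N) F j *~ mobius e).
  rewrite big_mkcond; apply: eq_big_nat => j /andP[j_gt0 _].
  rewrite -mulrz_sumr sum_mobius_common_divisors //.
  by case: coprime; rewrite ?mulr1z ?mulr0z.
rewrite (exchange_big_dep xpredT) //=; apply: eq_big_seq => e.
rewrite -dvdn_divisors // => e_n.
have e_gt0 := dvdn_gt0 n_gt0 e_n; rewrite -mulrz_suml; congr (_ *~ _).
apply: sum_dvdn_mul; rewrite ?iota_uniq // => j.
by rewrite !mem_index_iota muln_gt0 e_gt0 !ltnS mulnC leq_divRL.
Qed.

Lemma perm_divisors_div (n : nat) : (0 < n)%N ->
  perm_eq (divisors n) [seq (n %/ d)%N | d <- divisors n].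
Proof.
move=> n_gt0.
have divK d : (d %| n)%N -> (n %/ (n %/ d))%N = d by move=> d_n; rewrite divnA ?mulKn.
apply: uniq_perm; rewrite ?divisors_uniq //.
  rewrite map_inj_in_uniq ?divisors_uniq // => x y.
  by rewrite -!dvdn_divisors // => /divK{2}<- /divK{2}<- ->.
move=> x; rewrite -dvdn_divisors //; apply/idP/mapP => [x_n|[d]].
  by exists (n %/ x)%N; rewrite -?dvdn_divisors ?divK // dvdn_div.
by rewrite -dvdn_divisors // => d_n ->; apply: dvdn_div.
Qed.

(** * Sums of roots of unity *)

Section PrimitiveRootSums.

Variables (R : idomainType) (n : nat) (z : R).
Hypothesis z_prim : n.-primitive_root z.

Lemma prim_root_expz_eq1 (k : int) : (z ^ k == 1) = (n%:Z %| k)%Z.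
Proof.
case: k => k; first by rewrite dvdzE /= (prim_order_dvd z_prim).
by rewrite NegzE -invr_expz invr_eq1 dvdzE abszN (prim_order_dvd z_prim).
Qed.

Lemma sum_prim_root_expz (k : int) :
  \sum_(1 <= j < n.+1) (z ^ k) ^+ j = n%:R * (n%:Z %| k)%Z%:R.
Proof.
rewrite big_add1 big_mkord -prim_root_expz_eq1 /=.
have [->|zk_neq1] := eqVneq (z ^ k) 1.
  by under eq_bigr do rewrite expr1n; rewrite sumr_const card_ord mulr1.
under eq_bigr do rewrite exprS; rewrite mulr0 -mulr_sumr.
suff -> : \sum_(i < n) (z ^ k) ^+ i = 0 by rewrite mulr0.
apply/(mulfI (x := z ^ k - 1)); first by rewrite subr_eq0.
by rewrite -subrX1 mulr0 exprnP exprzAC -exprnP prim_expr_order // exp1rz subrr.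
Qed.

End PrimitiveRootSums.

Lemma sum_coprime_prim_root (R : idomainType) (n : nat) (z : R) (k : int) :
  n.-primitive_root z ->
  \sum_(1 <= j < n.+1 | coprime j n) (z ^ k) ^+ j =
  \sum_(d <- divisors n) d%:R * (mobius (n %/ d))%:~R * (d%:Z %| k)%Z%:R.
Proof.
move=> z_prim; have n_gt0 := prim_order_gt0 z_prim.
rewrite sum_coprime_mobius // (perm_big _ (perm_divisors_div n_gt0)) big_map.
apply: eq_big_seq => d; rewrite -dvdn_divisors // => d_n.
rewrite divnA // mulKn // -mulrzr mulrAC; congr (_ * _).
rewrite -(sum_prim_root_expz (dvdn_prim_root z_prim d_n)); apply: eq_bigr => j _.
by rewrite !exprnP !exprz_exp; congr (_ ^ _); rewrite PoszM; ring.
Qed.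

(** * The complex exponential *)

Section ComplexExponential.

Variable R : realType.
Implicit Types (x y : R) (z w : R[i]).

Lemma expCD z w : expC (z + w) = expC z * expC w.
Proof.
case: z w => [a b] [c d]; rewrite /expC /= expRD cosD sinD rmorphM mulrACA.
by congr (_ * _); apply/eqP; rewrite eq_complex /= eqxx [_ + _ * sin d]addrC eqxx.
Qed.

Lemma expC0 : expC (0 : R[i]) = 1.
Proof. by rewrite /expC expR0 cos0 sin0 mulr1. Qed.

Lemma expCN z : expC (- z) = (expC z)^-1.
Proof. by apply/esym/mulr1_eq; rewrite -expCD subrr expC0. Qed.

Lemma expCMn z (n : nat) : expC (z *+ n) = expC z ^+ n.
Proof. by elim: n => [|n IHn]; rewrite ?expC0 // mulrS exprS expCD IHn. Qed.

Lemma expCMz z (k : int) : expC (z *~ k) = expC z ^ k.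
Proof.
case: k => n; first exact: expCMn.
by rewrite NegzE mulrNz expCN expCMn exprnN.
Qed.

Lemma expC_imaginary y : expC (y%:C * 'i) = cos y +i* sin y.
Proof. by rewrite -complexiE /expC ReiNIm ImiRe /= oppr0 expR0 mul1r. Qed.

Lemma cos_lt1 x : 0 < x < pi *+ 2 -> cos x < 1.
Proof.
case/andP=> x_gt0 x_lt; have -> : x = (x / 2) *+ 2 by rewrite mulr2n -splitr.
have /(exprn_gt0 2) : 0 < sin (x / 2) by apply: sin_gt0_pi; move: x_lt; lra.
by rewrite cos_mulr2n cos2sin2; lra.
Qed.

Lemma expC_imaginary_neq1 y : 0 < y < pi *+ 2 -> expC (y%:C * 'i) != 1.
Proof.
move=> /cos_lt1 cosy; rewrite expC_imaginary eq_complex negb_and /=.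
by rewrite lt_eqF.
Qed.

Definition principal_root (n : nat) : R[i] := expC ((pi *+ 2 / n%:R)%:C * 'i).

Lemma principal_rootX (n j : nat) :
  principal_root n ^+ j = expC ((pi *+ 2 / n%:R *+ j)%:C * 'i).
Proof. by rewrite -expCMn rmorphMn -mulrnAl. Qed.

Lemma principal_root_prim (n : nat) :
  (0 < n)%N -> n.-primitive_root (principal_root n).
Proof.
move=> n_gt0; rewrite /primitive_root_of_unity n_gt0; apply/forallP => j.
have nR_gt0 : (0 : R) < n%:R by rewrite ltr0n.
have pi2_gt0 : (0 : R) < pi *+ 2 by rewrite mulrn_wgt0 ?pi_gt0.
rewrite unity_rootE principal_rootX -mulr_natr; apply/eqP.
have [j_n|j_neq] := eqVneq j.+1 n.
  by rewrite j_n divfK ?lt0r_neq0 // expC_imaginary cos2pi sin2pi eqxx.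
apply/negbTE/expC_imaginary_neq1/andP; split.
  by rewrite mulr_gt0 ?divr_gt0 ?ltr0n.
by rewrite mulrAC ltr_pdivrMr // ltr_pM2l // ltr_nat ltn_neqAle j_neq ltn_ord.
Qed.

End ComplexExponential.

(** * Ramanujan sums *)

Lemma ramanujan_sumE (R : realType) (n : nat) (k : int) : (0 < n)%N ->
  ramanujan_sum R n k =
  \sum_(d <- divisors n) d%:R * (mobius (n %/ d))%:~R * (d%:Z %| k)%Z%:R.
Proof.
move=> n_gt0; rewrite -(sum_coprime_prim_root k (principal_root_prim R n_gt0)).
apply: eq_bigr => j _; rewrite -expCMz -expCMn; congr expC.
by rewrite rmorphM rmorphMn fmorphV rmorph_nat /= -mulrzr -mulr_natr; ring.
Qed.

Lemma sum_divisors_ord (V : nmodType) (n N : nat) (F : nat -> V) :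
  (0 < n)%N -> (n <= N)%N ->
  \sum_(d <- divisors n) F d = \sum_(d < N.+1 | (d %| n)%N) F d.
Proof.
move=> n_gt0 n_le; rewrite -(big_mkord (fun d => d %| n)%N) -big_filter.
apply: perm_big; apply: uniq_perm; rewrite ?divisors_uniq ?filter_uniq ?iota_uniq //.
move=> d; rewrite mem_filter mem_index_iota -dvdn_divisors //=.
by case d_n: (d %| n)%N => //=; have := dvdn_leq n_gt0 d_n; lia.
Qed.

Lemma prod_natb (R : comPzSemiRingType) (I : finType) (b : pred I) :
  \prod_i (b i)%:R = [forall i, b i]%:R :> R.
Proof.
case: (boolP [forall i, b i]) => [/forallP b_all|/forallPn[i /negPf b_i]].
  by rewrite big1 // => i _; rewrite b_all.
by rewrite (bigD1 i) //= b_i mul0r.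
Qed.

Lemma prod_ramanujan_sum (R : realType) (r M : nat) (m : 'I_r -> nat)
    (k : 'I_r -> int) : (forall i, 0 < m i <= M)%N ->
  \prod_(i < r) ramanujan_sum R (m i) (k i) =
  \sum_(d : {ffun 'I_r -> 'I_M.+1} | [forall i, (d i %| m i)%N])
    (\prod_(i < r) ((d i)%:R * (mobius (m i %/ d i))%:~R))
      * [forall i, ((d i)%:Z %| k i)%Z]%:R.
Proof.
move=> m_bound; under eq_bigr => i _.
  have [m_gt0 m_le] := andP (m_bound i).
  rewrite ramanujan_sumE // (sum_divisors_ord _ m_gt0 m_le); over.
rewrite bigA_distr_big_dep; apply: eq_big => [d|d _].
  by apply/familyP/forallP.
by rewrite big_split prod_natb.
Qed.

(** * Simultaneous congruences *)

Lemma eqz_mod_divisor (d e x y : int) :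
  (d %| e)%Z -> (x = y %[mod e])%Z -> (x = y %[mod d])%Z.
Proof.
move=> d_e /eqP; rewrite eqz_mod_dvd => e_xy; apply/eqP; rewrite eqz_mod_dvd.
exact: dvdz_trans e_xy.
Qed.

Lemma zchinese_gcd (m n x y : int) : (x = y %[mod gcdz m n])%Z ->
  exists z, (z = x %[mod m])%Z /\ (z = y %[mod n])%Z.
Proof.
move/eqP; rewrite eqz_mod_dvd => /dvdzP[c xyE].
have [u [v uvE]] := Bezoutz m n; exists (x - c * u * m); split.
  by rewrite -mulNr addrC modzMDl.
suff -> : x - c * u * m = c * v * n + y by rewrite modzMDl.
by rewrite -[x](subrK y) xyE -uvE; ring.
Qed.

Lemma dvdn_biglcm_seq (I : Type) (s : seq I) (d : I -> nat) (n : nat) :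
  (\big[lcmn/1]_(i <- s) d i %| n)%N = all (fun i => d i %| n)%N s.
Proof.
rewrite -big_all; apply: (big_morph (fun l => l %| n)%N) => [l k|].
  exact: dvdn_lcm.
exact: dvd1n.
Qed.

Lemma eqz_mod_biglcm (I : Type) (s : seq I) (d : I -> nat) (x y : int) :
  (x == y %[mod (\big[lcmn/1]_(i <- s) d i)%N])%Z =
  all (fun i => x == y %[mod d i])%Z s.
Proof.
rewrite eqz_mod_dvd dvdzE /= dvdn_biglcm_seq; apply: eq_all => i.
by rewrite eqz_mod_dvd.
Qed.

Lemma gcdn_biglcml (I : Type) (s : seq I) (d : I -> nat) (n : nat) :
  gcdn (\big[lcmn/1%N]_(i <- s) d i) n = \big[lcmn/1%N]_(i <- s) gcdn (d i) n.
Proof.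
apply: (big_morph (gcdn^~ n)) => [l k|]; first exact: Order.NatDvd.meetUl.
exact: gcd1n.
Qed.

Lemma zchinese_seqP (I : eqType) (s : seq I) (d : I -> nat) (a : I -> int) :
  (exists x, {in s, forall i, x = a i %[mod d i]}%Z) <->
  {in s &, forall i j, a i = a j %[mod gcdz (d i) (d j)]}%Z.
Proof.
split=> [[x x_a] i j i_s j_s|].
  transitivity (x %% gcdz (d i) (d j))%Z.
    by apply/esym; apply: eqz_mod_divisor (x_a i i_s); apply: dvdz_gcdl.
  by apply: eqz_mod_divisor (x_a j j_s); apply: dvdz_gcdr.
elim: s => [|i s IHs] compat; first by exists 0.
have [j k j_s k_s|x x_a] := IHs.
  by apply: compat; rewrite inE ?j_s ?k_s orbT.
have : (x = a i %[mod gcdz (\big[lcmn/1%N]_(j <- s) d j)%N (d i)])%Z.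
  apply/eqP; rewrite /gcdz /= gcdn_biglcml eqz_mod_biglcm.
  apply/allP => j j_s; apply/eqP.
  rewrite -(compat j i) ?mem_head ?inE ?j_s ?orbT //.
  by apply: eqz_mod_divisor (x_a j j_s); apply: (dvdz_gcdl (d j) (d i)).
case/zchinese_gcd=> z [/eqP]; rewrite eqz_mod_biglcm => /allP z_x z_a.
by exists z => j; rewrite inE => /predU1P[->|j_s] //; rewrite -x_a //; apply/eqP/z_x.
Qed.

Lemma count_eqz_mod_period (n L : nat) (x : int) : (0 < L)%N ->
  (\sum_(n <= k < n + L) (k%:Z == x %[mod L])%Z = 1)%N.
Proof.
move=> L_gt0; rewrite -{1}[n]add0n big_addn addKn big_mkord.
have y_lt : (`|((x - n%:Z) %% L%:Z)%Z| < L)%N by lia.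
rewrite (bigD1 (Ordinal y_lt)) //= big1 ?addn0 => [|k].
  by rewrite PoszD gez0_abs ?modz_ge0 ?lt0n_neq0 // modzDml subrK eqxx.
apply: contraNeq; rewrite eqb0 negbK => /eqP k_x; apply/eqP/val_inj => /=.
by rewrite -modzDml -k_x PoszD modzDml addrK modz_small ?ltz_nat ?ltn_ord.
Qed.

Lemma count_eqz_mod (n L q : nat) (x : int) : (0 < L)%N ->
  (\sum_(n <= k < n + q * L) (k%:Z == x %[mod L])%Z = q)%N.
Proof.
move=> L_gt0; elim: q n => [|q IHq] n; first by rewrite addn0 big_geq.
rewrite mulSn addnA (big_cat_nat (n := n + L)) ?leq_addr //=.
by rewrite count_eqz_mod_period // IHq.
Qed.

Lemma lcm_fam_gt0 (r : nat) (d : 'I_r -> nat) :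
  (forall i, (0 < d i)%N) -> (0 < lcm_fam d)%N.
Proof.
move=> d_gt0; apply: (big_ind (fun l => 0 < l)%N) => // l k l_gt0 k_gt0.
by rewrite lcmn_gt0 l_gt0.
Qed.

Lemma zchinese_famP (r : nat) (a : 'I_r -> int) (d : 'I_r -> nat) :
  reflect (exists x, forall i, x = a i %[mod d i])%Z
    [forall i, forall j, ((gcdn (d i) (d j))%:Z %| a i - a j)%Z].
Proof.
have [solvable_compat compat_solvable] := zchinese_seqP (index_enum 'I_r) d a.
apply: (iffP forallP) => [compat|[x x_a] i].
  have [i j _ _|x x_a] := compat_solvable.
    by apply/eqP; rewrite eqz_mod_dvd; apply: (forallP (compat i)).
  by exists x => i; apply: x_a; apply: mem_index_enum.
apply/forallP => j; rewrite -eqz_mod_dvd; apply/eqP.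
by apply: solvable_compat; rewrite ?mem_index_enum //; exists x => l _.
Qed.

Lemma count_simultaneous_eqz_mod (r : nat) (a : 'I_r -> int) (d : 'I_r -> nat)
    (M : nat) : (0 < M)%N -> (lcm_fam d %| M)%N ->
  (\sum_(1 <= k < M.+1) [forall i, ((d i)%:Z %| (k%:Z - a i)%R)%Z]
    = M %/ lcm_fam d * N_compat a d)%N.
Proof.
move=> M_gt0 lcm_M; have lcm_gt0 := dvdn_gt0 M_gt0 lcm_M.
under eq_bigr => k _ do under eq_forallb => i do rewrite -eqz_mod_dvd.
rewrite /N_compat; case: zchinese_famP => [[x x_a]|no_solution]; last first.
  rewrite muln0 big1 // => k _; apply/eqP; rewrite eqb0.
  by apply: contra_notN no_solution => /forallP k_a; exists k%:Z => i; apply/eqP.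
rewrite muln1 -[RHS](count_eqz_mod 1 _ x lcm_gt0) divnK // add1n.
apply: eq_bigr => k _; congr nat_of_bool; rewrite eqz_mod_biglcm.
apply/forallP/allP => [k_a i _|k_a i]; first by rewrite x_a.
by rewrite -x_a k_a // mem_index_enum.
Qed.

(* The bound on [d i] only makes the index type finite: every divisor of
   [m i > 0] is at most [lcm_fam m]. *)
Theorem corollary2 (R : realType) (r : nat) (r_gt0 : (0 < r)%N)
    (m : 'I_r -> nat) (m_gt0 : forall i, (0 < m i)%N) (a : 'I_r -> int) :
  ((lcm_fam m)%:R : R[i])^-1 *
    \sum_(1 <= k < (lcm_fam m).+1)
      \prod_(i < r) ramanujan_sum R (m i) (k%:Z - a i)
  = \sum_(d : {ffun 'I_r -> 'I_(lcm_fam m).+1} | [forall i, (d i %| m i)%N])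
      (\prod_(i < r) ((d i)%:R * (mobius (m i %/ d i))%:~R))
        / (lcm_fam (fun i => d i))%:R
        * (N_compat a (fun i => d i))%:R.
Proof.
have M_gt0 := lcm_fam_gt0 m_gt0.
have m_M i : (m i %| lcm_fam m)%N by apply: biglcmn_sup.
have m_bound i : (0 < m i <= lcm_fam m)%N by rewrite m_gt0 dvdn_leq.
under eq_bigr do rewrite (prod_ramanujan_sum _ _ m_bound).
rewrite exchange_big mulr_sumr; apply: eq_bigr => d /forallP d_m /=.
rewrite -mulr_sumr -natr_sum.
have lcm_d_M : (lcm_fam (fun i => d i) %| lcm_fam m)%N.
  by apply/dvdn_biglcmP => i _; apply: dvdn_trans (m_M i).
rewrite count_simultaneous_eqz_mod // natrM natf_div //.
by rewrite mulrCA -[_ / _ * _ in LHS]mulrA mulKf ?mulrA // pnatr_eq0 -lt0n.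
Qed.
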